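(* By virtue of the semifunctor $\mathcal{C}$, the semicategories $\mathbf{PCS}$ and $\mathbf{PCL}$ are equivalent. Similarly, $\mathbf{PCL}$ is equivalent to the semicategory of partially $\bot$-distributive posets with truncated tensor products $A_{\mathcal{X}}\,\check\otimes\,B_{\mathcal{Y}}$ as hom-sets, via the ideal semifunctor sending $A_{\mathcal{X}}$ to $\mathcal{I}_{\mathcal{X}}A$ and mapping $A_{\mathcal{X}}\,\check\otimes\,B_{\mathcal{Y}}$ to $\mathcal{I}_{\mathcal{X}}A\,\check\otimes\,\mathcal{I}_{\mathcal{Y}}B$.
   Context: A semicategory satisfies the axioms of a category except for the existence of identity morphisms; a semifunctor preserves sources, targets and composition. Here a semifunctor is an equivalence if it induces bijections on all hom-sets and each object of the target (here a complete lattice) is isomorphic as a lattice to the image of some object. Relation product: $R\cdot S=\{(a,c):\exists b\ (a,b)\in R,(b,c)\in S\}$. Closure spaces: a closure space $A$ is a set $\mathcal{U}A$ with a collection $\mathcal{C}A$ of closed sets closed under arbitrary intersections (including $\bigcap\emptyset=\mathcal{U}A$); $\overline{X}$ is the least closed set containing $X$, $\bot_A=\overline{\emptyset}$. $A$ is polarized if all sets $x^{\perp}=\{y:\overline{\{x\}}\cap\overline{\{y\}}=\overline{\emptyset}\}$ are closed. $A\otimes B$ is the closure system of all $T\subseteq\mathcal{U}A\times\mathcal{U}B$ such that each $\{y:(x,y)\in T\}$ is closed in $B$ and each $\{x:(x,y)\in T\}$ is closed in $A$; its least member is $\overline{\emptyset}=(\bot_A\times\mathcal{U}B)\cup(\mathcal{U}A\times\bot_B)$.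 $\mathbf{PCS}$ has as objects the polarized closure spaces, as hom-sets $\mathbf{PCS}(A,B)=A\otimes B$, and the composite of $R\in A\otimes B$ and $S\in B\otimes C$ is the least member of $A\otimes C$ containing $(R\setminus\overline{\emptyset})\cdot(S\setminus\overline{\emptyset})$. Complete lattices: for a complete lattice $L$ put $\check L=L\setminus\{0_L\}$. $L\,\check\otimes\,M$ is the set of all down-sets $T$ of $\check L\times\check M$ such that $X\times Y\subseteq T$ implies $(\bigvee X,\bigvee Y)\in T$ for all nonempty $X\subseteq\check L$, $Y\subseteq\check M$. $\mathbf{PCL}$ has as objects the pseudocomplemented complete lattices (for each $x$ there is a greatest $y$ with $x\wedge y=0$), as hom-sets $\mathbf{PCL}(L,M)=L\,\check\otimes\,M$, and the composite of $R\in L\,\check\otimes\,M$ and $S\in M\,\check\otimes\,N$ is the least member of $L\,\check\otimes\,N$ containing $R\cdot S$. The semifunctor $\mathcal{C}:\mathbf{PCS}\to\mathbf{PCL}$ sends $A$ to the lattice $\mathcal{C}A$ of closed sets and $T\in A\otimes B$ to $\{(X,Y)\in\mathcal{C}A\times\mathcal{C}B: X\ne\overline{\emptyset},\,Y\neq\overline{\emptyset},\,X\times Y\subseteq T\}$. Posets: an augmented poset $A_{\mathcal{X}}=(A,\mathcal{X})$ is a poset $A$ with $\mathcal{X}\subseteq\mathcal{P}A$. $\Delta X=\bigcap\{\downarrow a:X\subseteq\downarrow a\}$. With $\dot{\mathcal{X}}=\mathcal{X}\cup\{\{x\}:x\in A\}$, an $\mathcal{X}$-ideal is a subset $I$ of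 $A$ with $\Delta X\subseteq I$ for all $X\in\dot{\mathcal{X}}$, $X\subseteq I$; $\mathcal{I}_{\mathcal{X}}A$ is the complete lattice of $\mathcal{X}$-ideals under inclusion and $\bot_A$ its least member; $\check A=A\setminus\bot_A$. $A_{\mathcal{X}}$ is partially $\bot$-distributive if $A$ is $\bot$-$\mathcal{X}$-distributive: for all $x\in A$ and $X\in\mathcal{X}$, $\downarrow x\cap\downarrow X\subseteq\bot_A$ implies $\downarrow x\cap\downarrow\Delta X\subseteq\bot_A$. Put $\check{\mathcal{X}}=\{X\setminus\bot_A: X\in\dot{\mathcal{X}},\ X\setminus\bot_A\ne\emptyset\text{ or }\bot_A=\emptyset\}$. $A_{\mathcal{X}}\,\check\otimes\,B_{\mathcal{Y}}$ is the closure system of all $T\subseteq\check A\times\check B$ such that each $\{y:(x,y)\in T\}$ is a $\check{\mathcal{Y}}$-ideal of the poset $\check B$ and each $\{x:(x,y)\in T\}$ is a $\check{\mathcal{X}}$-ideal of the poset $\check A$. The composite of $R\in A_{\mathcal{X}}\,\check\otimes\,B_{\mathcal{Y}}$ and $S\in B_{\mathcal{Y}}\,\check\otimes\,C_{\mathcal{Z}}$ is the least member of $A_{\mathcal{X}}\,\check\otimes\,C_{\mathcal{Z}}$ containing $R\cdot S$. The ideal semifunctor sends $T\in A_{\mathcal{X}}\,\check\otimes\,B_{\mathcal{Y}}$ to $\{(I,J)\in\mathcal{I}_{\mathcal{X}}A\times\mathcal{I}_{\mathcal{Y}}B: I\neq\bot_A,\ J\neq\bot_B,\ (I\setminus\bot_A)\times(J\setminus\bot_B)\subseteq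 T\}$. *)

(* Defs.v *)
From HB Require Import structures.
From mathcomp Require Import all_boot all_order.
From mathcomp Require Import boolp classical_sets.

Set Implicit Arguments.
Unset Strict Implicit.
Unset Printing Implicit Defensive.

Import Order.TTheory.

Local Open Scope classical_set_scope.

(* The notation [S \; R] of classical_sets applies R first, hence the swap. *)
Definition rel_prod (T1 T2 T3 : Type) (R : set (T1 * T2)) (S : set (T2 * T3)) :
  set (T1 * T3) := (S \; R)%relation.

(* The laws are kept apart from the data, in [is_semicategory] and
   [is_semifunctor]. *)
Record semicat_data := SemicatData {
  ob :> Type;
  hom : ob -> ob -> Type;
  comp : forall A B C, hom A B -> hom B C -> hom A C
}.

Definition is_semicategory (C : semicat_data) : Prop :=
  forall (X Y Z W : C) (R : hom X Y) (S : hom Y Z) (T : hom Z W),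
    comp (comp R S) T = comp R (comp S T).

Record semifunctor_data (C D : semicat_data) := SemifunctorData {
  fob :> C -> D;
  fhom : forall A B : C, hom A B -> hom (fob A) (fob B)
}.

Definition is_semifunctor (C D : semicat_data) (F : semifunctor_data C D) :=
  forall (X Y Z : C) (R : hom X Y) (S : hom Y Z),
    fhom F (comp R S) = comp (fhom F R) (fhom F S).

(* As there are no identities, isomorphism of objects is not a notion of the
   semicategory D itself: the relation [iso] has to be supplied. *)
Definition is_equivalence (C D : semicat_data) (iso : D -> D -> Prop)
    (F : semifunctor_data C D) : Prop :=
  [/\ is_semifunctor F,
      forall X Y : C, bijective (@fhom C D F X Y) &
      forall Y : D, exists X : C, iso Y (F X)].

(* The case F = set0 says that the whole carrier is closed. *)
Record closureSpace := ClosureSpace {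
  pt :> Type;
  closed : set (set pt);
  closed_bigcap : forall F : set (set pt),
    F `<=` closed -> closed (\bigcap_(X in F) X)
}.

Section ClosureSpaceTheory.
Variable A : closureSpace.
Implicit Types X Y : set A.

Definition cl X : set A := smallest (@closed A) X.

Definition bot : set A := cl set0.

Lemma closed_cl X : closed (cl X).
Proof. by apply: closed_bigcap => Y [cY _]. Qed.

Lemma sub_cl X : X `<=` cl X.
Proof. exact: sub_gen_smallest. Qed.

Lemma cl_min X Y : closed Y -> X `<=` Y -> cl X `<=` Y.
Proof. exact: smallest_sub. Qed.

Lemma closedT : closed [set: A].
Proof.
have -> : [set: A] = \bigcap_(X in set0) X by rewrite bigcap_set0.
by apply: closed_bigcap => X [].
Qed.

Lemma closedI X Y : closed X -> closed Y -> closed (X `&` Y).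
Proof.
move=> cX cY; have -> : X `&` Y = \bigcap_(Z in [set X; Y]) Z.
  by rewrite bigcap_setU !bigcap_set1.
by apply: closed_bigcap => Z [] ->.
Qed.

Lemma bot_min X : closed X -> bot `<=` X.
Proof. by move=> cX; apply: cl_min. Qed.

Lemma closed_bigcapi (I : Type) (D : set I) (F : I -> set A) :
  (forall i, D i -> closed (F i)) -> closed (\bigcap_(i in D) F i).
Proof.
move=> cF; have -> : \bigcap_(i in D) F i = \bigcap_(X in F @` D) X.
  by rewrite bigcap_image.
by apply: closed_bigcap => _ [i /cF + <-].
Qed.

Definition perp (x : A) : set A := [set y | cl [set x] `&` cl [set y] = bot].

End ClosureSpaceTheory.

Arguments bot : clear implicits.

Definition polarized (A : closureSpace) := forall x : A, closed (perp x).

Definition tensor (A B : closureSpace) : set (set (A * B)) :=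
  [set T | (forall x, closed [set y | T (x, y)]) /\
           (forall y, closed [set x | T (x, y)])].

Section CompleteLattices.
Variables (d : Order.disp_t) (L : tbLatticeType d).

Definition complete := forall X : set L, supremums X !=set0.

Definition pseudocomplemented :=
  forall x : L, exists y : L,
    (x `&` y = \bot)%O /\ forall z : L, (x `&` z = \bot)%O -> (z <= y)%O.

(* In a complete lattice this is the least upper bound of X, X = set0 included:
   classical_sets sets [supremum x0 set0 = x0]. *)
Definition bigjoin (X : set L) : L := supremum \bot%O X.

Lemma supremums_bigjoin (X : set L) : complete -> supremums X (bigjoin X).
Proof.
move=> cL; have [s sX] := cL X; rewrite /bigjoin /supremum.
have [X0|_] := eqVneq X set0; last by case: xgetP => [//|/(_ s)].
by rewrite X0; split => [x []|y _]; exact: le0x.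
Qed.

Definition punctured : set L := [set x | x <> \bot%O].

Lemma bigjoin_punctured (X : set L) :
  complete -> X !=set0 -> X `<=` punctured -> punctured (bigjoin X).
Proof.
move=> cL [x Xx] /(_ x Xx) x0 X0; apply: x0.
have [ubX _] := supremums_bigjoin X cL.
by apply/eqP; rewrite -lex0 -X0; exact: ubX.
Qed.

End CompleteLattices.

Arguments punctured {d} L.

Definition tensor_lattice d d' (L : tbLatticeType d) (M : tbLatticeType d') :
    set (set (L * M)) :=
  [set T |
   [/\ T `<=` punctured L `*` punctured M,
       forall p q : L * M, T p -> (punctured L `*` punctured M) q ->
         (q.1 <= p.1)%O -> (q.2 <= p.2)%O -> T q &
       forall (X : set L) (Y : set M), X !=set0 -> Y !=set0 ->
         X `<=` punctured L -> Y `<=` punctured M ->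
         X `*` Y `<=` T -> T (bigjoin X, bigjoin Y)]].

Arguments tensor : clear implicits.
Arguments tensor_lattice {d d'} L M.

Definition closed_lattice (A : closureSpace) := set_type (@closed A).

HB.instance Definition _ A := SubChoice.on (closed_lattice A).
HB.instance Definition _ A :=
  [SubChoice_isSubPOrder of closed_lattice A by <: with set_display].

Section ClosedLattice.
Variable A : closureSpace.
Implicit Types X Y Z : closed_lattice A.

Definition MkClosed (X : set A) (cX : closed X) : closed_lattice A :=
  SigSub (mem_set cX).

Lemma closed_val X : closed (val X). Proof. exact: set_mem (valP X). Qed.

Lemma leE X Y : (X <= Y)%O = (val X `<=` val Y) :> Prop.
Proof. by rewrite -Order.le_val subsetEset. Qed.

Definition cmeet X Y := MkClosed (closedI (closed_val X) (closed_val Y)).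
Definition cjoin X Y := MkClosed (closed_cl (val X `|` val Y)).

Lemma cmeetP X Y Z : (X <= cmeet Y Z)%O = (X <= Y)%O && (X <= Z)%O.
Proof.
apply/idP/andP => [|[]]; rewrite !leE /=.
  by move=> h; split=> x /h[].
by move=> XY XZ x Xx; split; [exact: XY|exact: XZ].
Qed.

Lemma cjoinP X Y Z : (cjoin X Y <= Z)%O = (X <= Z)%O && (Y <= Z)%O.
Proof.
apply/idP/andP => [|[]]; rewrite !leE /=.
  by move=> h; split=> x Xx; apply: h; apply: sub_cl; [left|right].
move=> XZ YZ; apply: cl_min; first exact: closed_val.
by move=> x [/XZ|/YZ].
Qed.

HB.instance Definition _ := Order.POrder_MeetJoin_isLattice.Build
  set_display (closed_lattice A) cmeetP cjoinP.

Lemma cbot_le X : (MkClosed (closed_cl set0) <= X)%O.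
Proof. by rewrite leE; apply: bot_min; exact: closed_val. Qed.

HB.instance Definition _ :=
  Order.hasBottom.Build set_display (closed_lattice A) cbot_le.

Lemma ctop_ge X : (X <= MkClosed (@closedT A))%O.
Proof. by rewrite leE. Qed.

HB.instance Definition _ :=
  Order.hasTop.Build set_display (closed_lattice A) ctop_ge.

Lemma val_meet X Y : val (X `&` Y)%O = val X `&` val Y. Proof. by []. Qed.

Lemma val_bot : val (\bot%O : closed_lattice A) = bot A. Proof. by []. Qed.

Lemma closed_lattice_complete : complete (closed_lattice A).
Proof.
move=> F; exists (MkClosed (closed_cl (\bigcup_(X in F) val X))); split=> X.
  by move=> FX; rewrite leE => x Xx; apply: sub_cl; exists X.
move=> ubX; rewrite leE; apply: cl_min; first exact: closed_val.
by move=> x [Y /ubX]; rewrite leE => /[apply].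
Qed.

Lemma closed_lattice_pseudocomplemented :
  polarized A -> pseudocomplemented (closed_lattice A).
Proof.
move=> pA X.
have cP : closed (\bigcap_(x in val X) perp x).
  by apply: closed_bigcapi => x _; exact: pA.
have clX (Z : closed_lattice A) z : val Z z -> cl [set z] `<=` val Z.
  by move=> Zz; apply: cl_min; [exact: closed_val|move=> _ ->].
exists (MkClosed cP); split.
  apply: val_inj; rewrite val_meet val_bot /=.
  apply/seteqP; split=> [x [Xx /(_ x Xx)]|].
    by rewrite /perp /= setIid => <-; exact: sub_cl.
  by apply: bot_min; apply: closedI => //; exact: closed_val.
move=> Z XZ; rewrite leE => z Zz x Xx; apply/seteqP; split.
  have <- : val (X `&` Z)%O = bot A by rewrite XZ.
  by move=> y [/(clX _ _ Xx) ? /(clX _ _ Zz) ?].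
by apply: bot_min; apply: closedI; exact: closed_cl.
Qed.

Lemma bigjoin_min (F : set (closed_lattice A)) (Y : set A) :
  closed Y -> (forall X, F X -> val X `<=` Y) -> val (bigjoin F) `<=` Y.
Proof.
move=> cY FY.
have [_ lubF] := supremums_bigjoin F closed_lattice_complete.
have /lubF : ubound F (MkClosed cY) by move=> X /FY; rewrite leE.
by rewrite leE.
Qed.

End ClosedLattice.

Lemma smallest_tensor (A B : closureSpace) (R : set (A * B)) :
  tensor A B (smallest (tensor A B) R).
Proof.
split=> [x|y].
  have -> : [set y | smallest (tensor A B) R (x, y)] =
      \bigcap_(T in [set T | tensor A B T /\ R `<=` T]) [set y | T (x, y)] by [].
  by apply: closed_bigcapi => T [[+ _] _]; exact.
have -> : [set x | smallest (tensor A B) R (x, y)] =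
    \bigcap_(T in [set T | tensor A B T /\ R `<=` T]) [set x | T (x, y)] by [].
by apply: closed_bigcapi => T [[_ +] _]; exact.
Qed.

Definition tensor_bot (A B : closureSpace) : set (A * B) :=
  smallest (tensor A B) set0.

Arguments tensor_bot : clear implicits.

Lemma tensor_botE (A B : closureSpace) :
  tensor_bot A B = bot A `*` [set: B] `|` [set: A] `*` bot B.
Proof.
apply/seteqP; split=> [|p].
  apply: smallest_sub => //; split=> [x|y].
    have [xA|xA] := pselect (bot A x).
      rewrite (_ : mkset _ = [set: B]); first exact: closedT.
      by apply/seteqP; split=> // y _; left.
    rewrite (_ : mkset _ = bot B); first exact: closed_cl.
    by apply/seteqP; split=> [y [[]|[]]|y]; last by right.
  have [yB|yB] := pselect (bot B y).
    rewrite (_ : mkset _ = [set: A]); first exact: closedT.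
    by apply/seteqP; split=> // x _; right.
  rewrite (_ : mkset _ = bot A); first exact: closed_cl.
  by apply/seteqP; split=> [x [[]|[]]|x]; last by left.
have [cB cA] := smallest_tensor (@set0 (A * B)).
by case: p => x y [[/= + _]|[_ /= +]]; [apply: bot_min (cA y) x|apply: bot_min (cB x) y].
Qed.

Record pcs_object := PcsObject {
  pcs_space :> closureSpace;
  pcs_polarized : polarized pcs_space
}.

Definition pcs_comp (A B C : pcs_object) (R : tensor A B) (S : tensor B C) :
    tensor A C :=
  SigSub (mem_set (smallest_tensor
    (rel_prod (val R `\` tensor_bot A B) (val S `\` tensor_bot B C)))).

Definition PCS : semicat_data := {|
  ob := pcs_object;
  hom := fun A B => tensor A B;
  comp := pcs_comp
|}.

Lemma smallest_tensor_lattice d d' (L : tbLatticeType d) (M : tbLatticeType d')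
    (R : set (L * M)) : complete L -> complete M ->
  R `<=` punctured L `*` punctured M ->
  tensor_lattice L M (smallest (tensor_lattice L M) R).
Proof.
move=> cL cM RLM; split.
- apply: smallest_sub => //; split=> // X Y X0 Y0 XL YM _.
  by split; exact: bigjoin_punctured.
- move=> p q Tp qLM qp1 qp2 T [tT RT].
  by have [_ tD _] := tT; exact: (tD p q (Tp T (conj tT RT))).
- move=> X Y X0 Y0 XL YM XYT T [tT RT].
  have [_ _ tJ] := tT; by apply: (tJ X Y) => // p /XYT; apply.
Qed.

Record pcl_object := PclObject {
  pcl_disp : Order.disp_t;
  pcl_lattice :> tbLatticeType pcl_disp;
  pcl_complete : complete pcl_lattice;
  pcl_pseudocomplemented : pseudocomplemented pcl_lattice
}.

Lemma rel_prod_punctured (L M N : pcl_object)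
    (R : tensor_lattice L M) (S : tensor_lattice M N) :
  rel_prod (val R) (val S) `<=` punctured L `*` punctured N.
Proof.
have [RLM _ _] := set_mem (valP R); have [SMN _ _] := set_mem (valP S).
by move=> p [b /RLM[/= ? _] /SMN[_ /= ?]].
Qed.

Definition pcl_comp (L M N : pcl_object)
    (R : tensor_lattice L M) (S : tensor_lattice M N) : tensor_lattice L N :=
  SigSub (mem_set (smallest_tensor_lattice (@pcl_complete L) (@pcl_complete N)
    (@rel_prod_punctured L M N R S))).

Definition PCL : semicat_data := {|
  ob := pcl_object;
  hom := fun L M => tensor_lattice L M;
  comp := pcl_comp
|}.

Definition pcl_iso (L M : PCL) : Prop :=
  exists f : L -> M, [/\ bijective f,
    {morph f : x y / (x `&` y)%O} & {morph f : x y / (x `|` y)%O}].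

Definition Cob (A : PCS) : PCL :=
  PclObject (@closed_lattice_complete A)
            (closed_lattice_pseudocomplemented (@pcs_polarized A)).

Definition Crel (A B : closureSpace) (T : set (A * B)) :
    set (closed_lattice A * closed_lattice B) :=
  [set XY | [/\ XY.1 <> \bot%O, XY.2 <> \bot%O & val XY.1 `*` val XY.2 `<=` T]].

Lemma Crel_tensor (A B : closureSpace) (T : set (A * B)) :
  tensor A B T ->
  tensor_lattice (closed_lattice A) (closed_lattice B) (Crel T).
Proof.
move=> [cB cA]; split=> [[X Y] []//| [X Y] [X' Y'] | F G F0 G0 FA GB FGT].
  move=> [_ _ /= XYT] [X'0 Y'0] /=; rewrite !leE => X'X Y'Y; split=> //.
  by move=> [x y] [/= /X'X Xx /Y'Y Yy]; exact: XYT.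
split=> /=; [exact: (bigjoin_punctured (@closed_lattice_complete _) F0 FA)
            |exact: (bigjoin_punctured (@closed_lattice_complete _) G0 GB)|].
move=> [x y] [/= Fx Gy].
apply: (bigjoin_min (cA y) _ Fx) => X FX {Fx}x Xx /=.
apply: (bigjoin_min (cB x) _ Gy) => Y GY {Gy}y Yy /=.
by have [_ _] := FGT (X, Y) (conj FX GY); apply.
Qed.

Definition Chom (A B : PCS) (T : hom A B) : hom (Cob A) (Cob B) :=
  SigSub (mem_set (Crel_tensor (set_mem (valP T)))).

Definition Cfunctor : semifunctor_data PCS PCL := {|
  fob := Cob;
  fhom := Chom
|}.

Record augPoset := AugPoset {
  aug_disp : Order.disp_t;
  aug_poset :> porderType aug_disp;
  aug_family : set (set aug_poset)
}.

Definition down d (A : porderType d) (X : set A) : set A :=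
  [set y | exists2 x, X x & (y <= x)%O].

(* The intersection over an empty family, i.e. when X has no upper bound, is
   the whole poset. *)
Definition Delta d (A : porderType d) (X : set A) : set A :=
  \bigcap_(a in [set a | X `<=` down [set a]]) down [set a].

Section AugmentedPosets.
Variable A : augPoset.

Definition dot_family : set (set A) := @aug_family A `|` range set1.

Definition is_ideal (I : set A) : Prop :=
  forall X, dot_family X -> X `<=` I -> Delta X `<=` I.

Lemma is_ideal_bigcap (F : set (set A)) :
  F `<=` is_ideal -> is_ideal (\bigcap_(I in F) I).
Proof.
move=> FI X dX XF x Dx I FI'; apply: (FI I FI' X dX) => //.
by move=> y /XF; exact.
Qed.

Definition ideal_space : closureSpace := ClosureSpace is_ideal_bigcap.

Definition ideal_bot : set A := bot ideal_space.

Definition partially_bot_distributive : Prop :=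
  forall (x : A) (X : set A), @aug_family A X ->
    down [set x] `&` down X `<=` ideal_bot ->
    down [set x] `&` down (Delta X) `<=` ideal_bot.

Definition check_poset := set_type (~` ideal_bot).

HB.instance Definition _ := SubChoice.on check_poset.
HB.instance Definition _ :=
  [SubChoice_isSubPOrder of check_poset by <: with aug_disp A].

Definition check_family : set (set check_poset) :=
  [set Y | exists X, [/\ dot_family X,
    (X `\` ideal_bot !=set0) \/ ideal_bot = set0 &
    Y = [set y : check_poset | X (val y)]]].

Definition check : augPoset := AugPoset check_family.

End AugmentedPosets.

Arguments dot_family : clear implicits.
Arguments ideal_bot : clear implicits.
Arguments check_family : clear implicits.

(* The closed sets of [ideal_space (check A)] are the ideals, with respect to
   the family [check_family A], of the poset [check_poset A]. *)
Definition trunc_tensor (A B : augPoset) :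
    set (set (check_poset A * check_poset B)) :=
  tensor (ideal_space (check A)) (ideal_space (check B)).

Arguments trunc_tensor : clear implicits.

Record pbd_object := PbdObject {
  pbd_poset :> augPoset;
  pbd_distributive : partially_bot_distributive pbd_poset
}.

Definition pbd_comp (A B C : pbd_object)
    (R : trunc_tensor A B) (S : trunc_tensor B C) : trunc_tensor A C :=
  SigSub (mem_set (@smallest_tensor (ideal_space (check A))
    (ideal_space (check C)) (rel_prod (val R) (val S)))).

(* PBD: partially bot-distributive posets. *)
Definition PBD : semicat_data := {|
  ob := pbd_object;
  hom := fun A B => trunc_tensor A B;
  comp := pbd_comp
|}.

Definition ideal_lattice (A : augPoset) := closed_lattice (ideal_space A).

Section Ideals.
Variable A : augPoset.

Lemma ideal_down (I : set A) x y : is_ideal I -> I x -> (y <= x)%O -> I y.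
Proof.
move=> iI Ix yx; apply: (iI [set x]); first by right; exists x.
  by move=> _ ->.
by move=> a /(_ x erefl) [_ -> xa]; exists a => //; exact: le_trans xa.
Qed.

Lemma ideal_principal (x : A) : is_ideal (down [set x]).
Proof. by move=> X _ Xx y; exact. Qed.

Lemma cl_principal (x : A) : cl (A := ideal_space A) [set x] = down [set x].
Proof.
apply/seteqP; split.
  apply: cl_min; first exact: ideal_principal.
  by move=> _ ->; exists x.
move=> y [_ -> yx]; apply: ideal_down yx; first exact: (@closed_cl (ideal_space A)).
exact: (@sub_cl (ideal_space A)).
Qed.

Lemma ideal_polarized :
  partially_bot_distributive A -> polarized (ideal_space A).
Proof.
have botI : is_ideal (ideal_bot A) := @closed_cl (ideal_space A) set0.
move=> dA x X dX Xx y Dy; rewrite /perp /= !cl_principal.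
have sub : down [set x] `&` down X `<=` ideal_bot A.
  move=> z [zx [w /Xx]]; rewrite /perp /= !cl_principal => xw zw.
  rewrite /ideal_bot -xw.
  by split=> //; exists w.
have sub' : down [set x] `&` down (Delta X) `<=` ideal_bot A.
  case: dX => [fX|[w _ wX]]; first exact: dA.
  move=> z [zx [v + zv]]; rewrite -wX => /(_ w) [u ->|_ -> vw]; first by exists w.
  by apply: sub; split=> //; exists w; [rewrite -wX|exact: le_trans vw].
apply/seteqP; split.
  by move=> z [zx [_ -> zy]]; apply: sub'; split=> //; exists y.
apply: (@bot_min (ideal_space A)); apply: (@closedI (ideal_space A));
  exact: ideal_principal.
Qed.

Lemma ideal_extend (S : set (check_poset A)) :
  is_ideal (A := check A) S ->
  is_ideal [set x | ideal_bot A x \/ exists2 s, S s & val s = x].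
Proof.
have botI : is_ideal (ideal_bot A) := @closed_cl (ideal_space A) set0.
move=> iS X dX XS x Dx.
have [xb|xb] := pselect (ideal_bot A x); first by left.
have [nX|nX] := pselect ((X `\` ideal_bot A !=set0) \/ ideal_bot A = set0).
  right; exists (SigSub (mem_set xb : x \in ~` ideal_bot A)) => //.
  apply: (iS [set y | X (val y)]); first by left; exists X.
    move=> y /= /XS[yb|[s Ss /val_inj <-]//].
    by have := set_mem (valP y).
  move=> a aX; exists a => //.
  have : down [set val a] x.
    apply: Dx => y Xy.
    have [yb|yb] := pselect (ideal_bot A y).
      by apply: (@bot_min (ideal_space A)) yb; exact: ideal_principal.
    have [_ -> ya] := aX (SigSub (mem_set yb : y \in ~` ideal_bot A)) Xy.
    by exists (val a).
  by move=> [_ -> xa].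
case: xb; apply: (botI X dX) Dx => y Xy; apply: contrapT => yb.
by apply: nX; left; exists y.
Qed.

End Ideals.

Definition Iob (A : PBD) : PCL :=
  PclObject (@closed_lattice_complete (ideal_space A))
    (closed_lattice_pseudocomplemented
      (ideal_polarized (@pbd_distributive A))).

Definition Irel (A B : augPoset) (T : set (check_poset A * check_poset B)) :
    set (ideal_lattice A * ideal_lattice B) :=
  [set IJ : ideal_lattice A * ideal_lattice B |
   [/\ IJ.1 <> \bot%O, IJ.2 <> \bot%O &
    forall (x : check_poset A) (y : check_poset B),
      (val IJ.1 : set A) (val x) -> (val IJ.2 : set B) (val y) -> T (x, y)]].

Lemma Irel_tensor (A B : augPoset) (T : set (check_poset A * check_poset B)) :
  trunc_tensor A B T ->
  tensor_lattice (ideal_lattice A) (ideal_lattice B) (Irel T).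
Proof.
move=> [cB cA]; split=> [[I J] []//| [I J] [I' J'] | F G F0 G0 FA GB FGT].
  move=> [_ _ /= IJT] [I'0 J'0] /=; rewrite !leE => I'I J'J; split=> //.
  by move=> x y /I'I Ix /J'J Jy; exact: IJT.
split=> /=; [exact: (bigjoin_punctured (@closed_lattice_complete _) F0 FA)
            |exact: (bigjoin_punctured (@closed_lattice_complete _) G0 GB)|].
move=> x y Fx Gy.
have xb := set_mem (valP x) : ~ ideal_bot A (val x).
have yb := set_mem (valP y) : ~ ideal_bot B (val y).
suff : [set x | ideal_bot A x \/
         exists2 s : check_poset A, T (s, y) & val s = x] (val x).
  by move=> [//|[s Ts /val_inj <-]].
apply: (bigjoin_min (A := ideal_space A) (ideal_extend (cA y)) _ Fx).
move=> I FI {x Fx xb} x Ix.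
have [xb|xb] := pselect (ideal_bot A x); [by left|right].
exists (SigSub (mem_set xb : x \in ~` ideal_bot A)) => //.
set x' := SigSub _.
suff : [set y | ideal_bot B y \/
         exists2 s : check_poset B, T (x', s) & val s = y] (val y).
  by move=> [//|[s Ts /val_inj <-]].
apply: (bigjoin_min (A := ideal_space B) (ideal_extend (cB x')) _ Gy).
move=> J GJ {y Gy yb} y Jy.
have [yb|yb] := pselect (ideal_bot B y); [by left|right].
exists (SigSub (mem_set yb : y \in ~` ideal_bot B)) => //.
by have [_ _] := FGT (I, J) (conj FI GJ); apply.
Qed.

Definition Ihom (A B : PBD) (T : hom A B) : hom (Iob A) (Iob B) :=
  SigSub (mem_set (Irel_tensor (set_mem (valP T)))).

Definition Ifunctor : semifunctor_data PBD PCL := {|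
  fob := Iob;
  fhom := Ihom
|}.

(* Main.v *)
From mathcomp Require Import all_boot all_order.
From mathcomp Require Import boolp classical_sets.
Require Import Defs.

Set Implicit Arguments.
Unset Strict Implicit.
Unset Printing Implicit Defensive.

Import Order.TTheory.

Local Open Scope classical_set_scope.

(** Associativity in PCL. The point is that taking the least tensor above R.S
    loses nothing when T is composed afterwards: if (R.S).T is contained in a
    tensor Q, so is the product of the closure of R.S with T. For this one
    compares R.S with its residual along T, the relation of all (a, c) such that
    (a, e) is in Q whenever (c', e) is in T and c' meets c. The residual contains
    R.S because the sections of S and T are down-sets. It is itself a tensor because N
    is pseudocomplemented: an element c' that meets a join meets one of the
    joined elements ([bigjoin_meets], [residual_tensor]). Since a nonzero c meets
    itself, the residual composed with T lands in Q. By symmetry the same holds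
    for the closure of S.T, so both bracketings of a triple composite are the
    least tensor above R.S.T. The laws of the other two semicategories are pulled
    back along the faithful semifunctors C and I.

    The closure semifunctor C. A closed set is the join of the closures of its
    points outside bot, so a lattice tensor U is determined by the pairs of
    points (x, y) whose closures are related by U. Those pairs, together with
    the least tensor, form a tensor of closure spaces [point_rel U], and this
    is inverse to C ([Chom_bij]). Preservation of composition follows from the
    minimality of both closures, one of them transported by [point_rel].

    The ideal semifunctor I. Ideals of the poset punctured at bot are the traces
    of ideals, so adding the least tensor to a truncated tensor is a bijection
    onto the tensors of the two ideal spaces, monotone both ways and compatible
    with composition. The ideal semifunctor is C after this extension
    ([IhomE]), hence inherits everything from C.

    Objects. In a complete lattice L whose distinguished family consists of all
    subsets, Delta X is the principal ideal of the join of X. So the ideals are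
    exactly the principal ones and form a lattice isomorphic to L;
    pseudocomplementation of L says that this augmented poset is partially
    bot-distributive. Its ideal space serves for C as well. *)

(** * Associativity along faithful semifunctors *)

(** A semifunctor that is injective on homs carries the associativity law
    backwards, which reduces the law in all three semicategories to PCL. *)
Lemma faithful_reflects_semicategory (C D : semicat_data)
    (F : semifunctor_data C D) :
  is_semifunctor F -> (forall X Y : C, injective (@fhom C D F X Y)) ->
  is_semicategory D -> is_semicategory C.
Proof.
move=> FF injF assocD X Y Z W R S T; apply: injF.
by rewrite !FF assocD.
Qed.

(** * Joins in complete lattices *)

Lemma bigjoin_leP d (L : tbLatticeType d) (X : set L) (y : L) :
  complete L -> (bigjoin X <= y)%O <-> forall x, X x -> (x <= y)%O.
Proof.
move=> cL; have [ub lub] := supremums_bigjoin X cL; split; last exact: lub.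
by move=> Xy x /ub xX; exact: le_trans Xy.
Qed.

Lemma le_bigjoin d (L : tbLatticeType d) (X : set L) (x : L) :
  complete L -> X x -> (x <= bigjoin X)%O.
Proof. by move=> cL; apply: (bigjoin_leP X _ cL).1. Qed.

Lemma bigjoin1 d (L : tbLatticeType d) (x : L) :
  complete L -> bigjoin [set x] = x.
Proof.
move=> cL; apply/le_anti; rewrite le_bigjoin // andbT.
by apply/bigjoin_leP => // _ ->.
Qed.

(** The form in which pseudocomplements are used: if every element of X were
    disjoint from c, all of them, hence also their join, would lie below the
    pseudocomplement of c. *)
Lemma bigjoin_meets d (L : tbLatticeType d) (X : set L) (c : L) :
  complete L -> pseudocomplemented L ->
  (bigjoin X `&` c)%O <> \bot%O -> exists2 x, X x & (x `&` c)%O <> \bot%O.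
Proof.
move=> cL pL Xc; apply: contrapT => noX; apply: Xc.
have [y [cy ymax]] := pL c.
have Xy : (bigjoin X <= y)%O.
  apply/bigjoin_leP => // x Xx; apply: ymax; rewrite meetC.
  by apply: contrapT => xc; apply: noX; exists x.
by apply/eqP; rewrite -lex0 -cy (meetC c) leI2.
Qed.

(** * Lattice tensors by their sections *)

Definition punctured_ideal d (L : tbLatticeType d) (V : set L) : Prop :=
  [/\ V `<=` punctured L,
      forall y z, V y -> z <> \bot%O -> (z <= y)%O -> V z &
      forall Y, Y !=set0 -> Y `<=` V -> V (bigjoin Y)].

(** Closure under joins of rectangles splits into closure under joins in each
    variable separately: a one-sided join is that of a rectangle with a singleton
    side, and a rectangle is joined first along Y, then along X. *)
Lemma tensor_latticeP d d' (L : tbLatticeType d) (M : tbLatticeType d')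
    (T : set (L * M)) : complete L -> complete M ->
  tensor_lattice L M T <->
  (forall x, punctured_ideal [set y | T (x, y)]) /\
  (forall y, punctured_ideal [set x | T (x, y)]).
Proof.
move=> cL cM; split=> [[Tp Td Tj]|[T1 T2]].
  split=> [x|y]; split.
  - by move=> y /Tp[].
  - move=> y z /= Txy z0 zy; have [/= x0 _] := Tp _ Txy.
    exact: (Td (x, y) (x, z)).
  - move=> Y Y0 YT /=; rewrite -(bigjoin1 x cL).
    apply: Tj => //; first by exists x.
    + by case: Y0 => y /YT/Tp[/= x0 _] _ ->.
    + by move=> y /YT/Tp[].
    + by move=> [_ y] [/= -> /YT].
  - by move=> x /Tp[].
  - move=> x z /= Txy z0 zx; have [/= _ y0] := Tp _ Txy.
    exact: (Td (x, y) (z, y)).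
  - move=> X X0 XT /=; rewrite -(bigjoin1 y cM).
    apply: Tj => //; first by exists y.
    + by move=> x /XT/Tp[].
    + by case: X0 => x /XT/Tp[/= _ y0] _ ->.
    + by move=> [x _] [/= /XT ? ->].
split=> [[x y] Txy|[x y] [x' y'] Txy [/= x'0 y'0] x'x y'y|X Y X0 Y0 _ _ XYT].
- by split=> /=; [have [+ _ _] := T2 y|have [+ _ _] := T1 x]; apply.
- have [_ d1 _] := T1 x'; have [_ d2 _] := T2 y.
  exact: (d1 y) (d2 x _ _ _ _) _ _.
- have [_ _ j2] := T2 (bigjoin Y); apply: j2 => // x Xx.
  have [_ _ j1] := T1 x; apply: j1 => // y Yy.
  exact: XYT.
Qed.

Definition converse (S T : Type) (R : set (S * T)) : set (T * S) :=
  [set p | R (p.2, p.1)].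

Lemma converse_tensor_lattice d d' (L : tbLatticeType d) (M : tbLatticeType d')
    (T : set (L * M)) : complete L -> complete M ->
  tensor_lattice L M T -> tensor_lattice M L (converse T).
Proof. by move=> cL cM /tensor_latticeP-[]// T1 T2; apply/tensor_latticeP. Qed.

(** * Associativity in PCL *)

(** The usual residual would ask for (p.1, e) in Q only when c = p.2. In general
    that relation is not closed under joins in the second variable; asking it for
    all c that meet p.2 repairs this. *)
Definition residual d d' d'' (L : tbLatticeType d) (N : tbLatticeType d')
    (K : tbLatticeType d'') (T : set (N * K)) (Q : set (L * K)) : set (L * N) :=
  [set p | [/\ p.1 <> \bot%O, p.2 <> \bot%O &
    forall c e, T (c, e) -> (p.2 `&` c)%O <> \bot%O -> Q (p.1, e)]].

Lemma residual_tensor (L N K : pcl_object) (T : set (N * K)) (Q : set (L * K)) :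
  tensor_lattice L K Q -> tensor_lattice L N (residual T Q).
Proof.
have cL := @pcl_complete L; have cN := @pcl_complete N.
have cK := @pcl_complete K.
move=> /tensor_latticeP-[]// _ Q2; apply/tensor_latticeP => //.
split=> [x|y]; split.
- by move=> y [].
- move=> y z [/= x0 y0 xyQ] z0 zy; split=> //= c e Tce zc.
  apply: xyQ Tce _ => yc; apply: zc.
  by apply/eqP; rewrite -lex0 -yc leI2.
- move=> Y [y0 Yy0] YW; split=> /=.
  + by have [] := YW y0 Yy0.
  + apply: bigjoin_punctured => //; first by exists y0.
    by move=> y /YW[].
  + move=> c e Tce.
    case/(bigjoin_meets cN (@pcl_pseudocomplemented N)) => y /YW[_ _ /= yQ].
    exact: yQ Tce.
- by move=> x [].
- move=> x z [/= x0 y0 xyQ] z0 zx; split=> //= c e Tce yc.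
  have [_ d2 _] := Q2 e; exact: (d2 x) (xyQ c e Tce yc) _ _.
- move=> X X0 XW; split=> /=.
  + by apply: bigjoin_punctured => // x /XW[].
  + by case: X0 => x /XW[].
  + move=> c e Tce yc; have [_ _ j2] := Q2 e; apply: j2 => // x /XW[_ _ /= xQ].
    exact: xQ Tce yc.
Qed.

(** The half of associativity that moves a closure out of the left factor. *)
Lemma closure_prod_sub (L N K : pcl_object) (P : set (L * N)) (T : set (N * K))
    (Q : set (L * K)) :
  tensor_lattice N K T -> tensor_lattice L K Q ->
  P `<=` punctured L `*` punctured N ->
  (forall a b c, P (a, b) -> c <> \bot%O -> (c <= b)%O -> P (a, c)) ->
  rel_prod P T `<=` Q ->
  rel_prod (smallest (tensor_lattice L N) P) T `<=` Q.
Proof.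
move=> tT tQ Pp Pd PTQ.
have cN := @pcl_complete N; have cK := @pcl_complete K.
have PW : smallest (tensor_lattice L N) P `<=` residual T Q.
  apply: smallest_sub; first exact: residual_tensor.
  move=> [a b] Pab; have [/= a0 b0] := Pp _ Pab; split=> //= c e Tce bc.
  (* Both b and c may be shrunk to their meet, which is nonzero. *)
  apply: PTQ; exists (b `&` c)%O; first by apply: (Pd a b) => //; exact: leIl.
  have [_ T2] := (tensor_latticeP T cN cK).1 tT; have [_ d2 _] := T2 e.
  by apply: (d2 c) => //; exact: leIr.
move=> [a e] [c /PW[/= _ c0 acQ] Tce].
by apply: acQ Tce _; rewrite meetxx.
Qed.

(** The mirror image, obtained by passing to converse relations. *)
Lemma closure_prod_sub_r (L N K : pcl_object) (P : set (N * L))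
    (T : set (K * N)) (Q : set (K * L)) :
  tensor_lattice K N T -> tensor_lattice K L Q ->
  P `<=` punctured N `*` punctured L ->
  (forall a b c, P (b, a) -> c <> \bot%O -> (c <= b)%O -> P (c, a)) ->
  rel_prod T P `<=` Q ->
  rel_prod T (smallest (tensor_lattice N L) P) `<=` Q.
Proof.
have cL := @pcl_complete L; have cN := @pcl_complete N.
have cK := @pcl_complete K.
move=> tT tQ Pp Pd TPQ [e a] [c Tec Pca].
apply: (@closure_prod_sub L N K (converse P) (converse T) (converse Q)
          _ _ _ Pd _ (a, e)).
- exact: converse_tensor_lattice.
- exact: converse_tensor_lattice.
- by move=> p /Pp[].
- by move=> p [b Pb Tb]; apply: TPQ; exists b.
- exists c => //= W [tW PW].
  have [tW' PW'] : tensor_lattice N L (converse W) /\ P `<=` converse W.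
    by split; [exact: converse_tensor_lattice|move=> [x y] Pxy; exact: PW].
  exact: (Pca (converse W)).
Qed.

Lemma PCL_semicategory : is_semicategory PCL.
Proof.
move=> L M N K R S T; apply: val_inj => /=.
have cL := @pcl_complete L; have cM := @pcl_complete M.
have cN := @pcl_complete N; have cK := @pcl_complete K.
have tR : tensor_lattice L M (val R) := set_mem (valP R).
have tS : tensor_lattice M N (val S) := set_mem (valP S).
have tT : tensor_lattice N K (val T) := set_mem (valP T).
have tRS : tensor_lattice L N (val (comp R S)) := set_mem (valP (comp R S)).
have tST : tensor_lattice M K (val (comp S T)) := set_mem (valP (comp S T)).
have [S1 S2] := (tensor_latticeP _ cM cN).1 tS.
apply/seteqP; split; apply: smallest_sub.
- exact: (set_mem (valP (comp R (comp S T)))).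
- apply: closure_prod_sub => //.
  + exact: (set_mem (valP (comp R (comp S T)))).
  + exact: rel_prod_punctured.
  + move=> a b c [x Rax Sxb] c0 cb; exists x => //.
    by have [_ d1 _] := S1 x; exact: (d1 b).
  + move=> [a e] [c [b Rab Sbc] Tce]; apply: sub_gen_smallest; exists b => //.
    by apply: sub_gen_smallest; exists c.
- exact: (set_mem (valP (comp (comp R S) T))).
- apply: closure_prod_sub_r => //.
  + exact: (set_mem (valP (comp (comp R S) T))).
  + exact: rel_prod_punctured.
  + move=> e b c [x Sbx Txe] c0 cb; exists x => //.
    by have [_ d2 _] := S2 x; exact: (d2 b).
  + move=> [a e] [b Rab [c Sbc Tce]]; apply: sub_gen_smallest; exists c => //.
    by apply: sub_gen_smallest; exists b.
Qed.

(** * Closure spaces and the semifunctor C *)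

Definition point_closure (A : closureSpace) (x : A) : closed_lattice A :=
  MkClosed (closed_cl [set x]).

Lemma point_closure_leP (A : closureSpace) (x : A) (X : closed_lattice A) :
  (point_closure x <= X)%O <-> val X x.
Proof.
rewrite leE; split=> [|Xx]; first by apply; exact: sub_cl.
by apply: cl_min; [exact: closed_val|move=> _ ->].
Qed.

Lemma point_closure_neq0 (A : closureSpace) (x : A) :
  point_closure x <> \bot%O <-> ~ bot A x.
Proof.
rewrite -val_bot -point_closure_leP lex0.
by split=> xb; [move=> /eqP|move=> /eqP xb'].
Qed.

Lemma bigjoin_points (A : closureSpace) (X : closed_lattice A) :
  bigjoin [set point_closure x | x in val X `\` bot A] = X.
Proof.
have cA := @closed_lattice_complete A; apply/le_anti/andP; split.
  by apply/bigjoin_leP => // _ [x [Xx _] <-]; apply/point_closure_leP.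
rewrite leE => x Xx.
have [xb|xb] := pselect (bot A x).
  by apply: bot_min xb; exact: closed_val.
by apply/point_closure_leP/le_bigjoin => //; exists x.
Qed.

Lemma neq0_point (A : closureSpace) (X : closed_lattice A) :
  X <> \bot%O -> val X `\` bot A !=set0.
Proof.
move=> X0; apply: contrapT => noX; apply: X0; apply/eqP; rewrite -lex0 leE.
by move=> x Xx; apply: contrapT => xb; apply: noX; exists x.
Qed.

(** If V is nonempty, it consists of all nonzero elements below its join, and the
    set in question is that join; otherwise it is bot. *)
Lemma closed_of_punctured_ideal (A : closureSpace)
    (V : set (closed_lattice A)) :
  punctured_ideal V -> closed [set x | bot A x \/ V (point_closure x)].
Proof.
move=> [Vp Vd Vj]; have cA := @closed_lattice_complete A.
have [V0|V0] := pselect (V !=set0); last first.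
  rewrite (_ : mkset _ = bot A); first exact: closed_cl.
  apply/seteqP; split=> [x []// Vx|x]; last by left.
  by case: V0; exists (point_closure x).
rewrite (_ : mkset _ = val (bigjoin V)); first exact: closed_val.
apply/seteqP; split=> [x [xb|Vx]|x Vx].
- by apply: bot_min xb; exact: closed_val.
- by apply/point_closure_leP; exact: le_bigjoin.
- have [xb|xb] := pselect (bot A x); [by left|right].
  apply: (Vd (bigjoin V)); first exact: Vj.
    exact/point_closure_neq0.
  exact/point_closure_leP.
Qed.

(** The candidate inverse of [Crel]. The least tensor must be included because a
    tensor contains all pairs with a coordinate in bot, while U does not relate
    the bottom element to anything. *)
Definition point_rel (A B : closureSpace)
    (U : set (closed_lattice A * closed_lattice B)) : set (A * B) :=
  [set p | tensor_bot A B p \/ U (point_closure p.1, point_closure p.2)].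

Lemma tensor_botP (A B : closureSpace) (x : A) (y : B) :
  tensor_bot A B (x, y) <-> bot A x \/ bot B y.
Proof.
rewrite tensor_botE; split=> [[[]|[]]|[]]; [by left|by right|by left|by right].
Qed.

Lemma tensor_bot_sub (A B : closureSpace) (T : set (A * B)) :
  tensor A B T -> tensor_bot A B `<=` T.
Proof. by move=> tT; apply: smallest_sub. Qed.

(** Over a point of bot the section is everything, so only the sections over the
    other points have to be examined. *)
Lemma sections_tensor (A B : closureSpace) (T : set (A * B)) :
  tensor_bot A B `<=` T ->
  (forall x, ~ bot A x -> closed [set y | T (x, y)]) ->
  (forall y, ~ bot B y -> closed [set x | T (x, y)]) -> tensor A B T.
Proof.
move=> bT cB cA; split=> [x|y].
  have [xb|] := pselect (bot A x); last exact: cB.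
  rewrite (_ : mkset _ = [set: B]); first exact: closedT.
  by apply/seteqP; split=> // y _; apply: bT; apply/tensor_botP; left.
have [yb|] := pselect (bot B y); last exact: cA.
rewrite (_ : mkset _ = [set: A]); first exact: closedT.
by apply/seteqP; split=> // x _; apply: bT; apply/tensor_botP; right.
Qed.

Lemma point_rel_tensor (A B : closureSpace)
    (U : set (closed_lattice A * closed_lattice B)) :
  tensor_lattice (closed_lattice A) (closed_lattice B) U ->
  tensor A B (point_rel U).
Proof.
move=> /tensor_latticeP.
case=> [||U1 U2]; [exact: closed_lattice_complete..|].
apply: sections_tensor => [p|x xb|y yb]; first by left.
  rewrite (_ : mkset _ = [set y | bot B y \/ U (point_closure x, point_closure y)]).
    exact: (closed_of_punctured_ideal (U1 _)).
  apply/seteqP; split=> y; rewrite /point_rel /= tensor_botP;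
    by [move=> [[//|]|]; [left|right]|move=> []; [left; right|right]].
rewrite (_ : mkset _ = [set x | bot A x \/ U (point_closure x, point_closure y)]).
  exact: (closed_of_punctured_ideal (U2 _)).
apply/seteqP; split=> x; rewrite /point_rel /= tensor_botP;
  by [move=> [[|//]|]; [left|right]|move=> []; [left; left|right]].
Qed.

Lemma Crel_point_rel (A B : closureSpace)
    (U : set (closed_lattice A * closed_lattice B)) :
  tensor_lattice (closed_lattice A) (closed_lattice B) U ->
  Crel (point_rel U) = U.
Proof.
move=> [Up Ud Uj]; apply/seteqP; split=> [[X Y] [/= X0 Y0 XYU]|[X Y] UXY].
  rewrite -(bigjoin_points X) -(bigjoin_points Y).
  apply: Uj.
  - by have [x Xx] := neq0_point X0; exists (point_closure x); exists x.
  - by have [y Yy] := neq0_point Y0; exists (point_closure y); exists y.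
  - by move=> _ [x [_ xb] <-]; apply/point_closure_neq0.
  - by move=> _ [y [_ yb] <-]; apply/point_closure_neq0.
  - move=> [_ _] [/= [x [Xx xb] <-] [y [Yy yb] <-]].
    by have [/tensor_botP[]|] := XYU (x, y) (conj Xx Yy).
have [/= X0 Y0] := Up _ UXY; split=> // -[x y] [/= Xx Yy].
have [|/tensor_botP b] := pselect (tensor_bot A B (x, y)); first by left.
right; apply: (Ud (X, Y)) => //=; last 2 first.
- exact/point_closure_leP.
- exact/point_closure_leP.
by split; apply/point_closure_neq0 => ?; apply: b; [left|right].
Qed.

Lemma Crel_points (A B : closureSpace) (T : set (A * B)) (x : A) (y : B) :
  tensor A B T -> T (x, y) -> ~ tensor_bot A B (x, y) ->
  Crel T (point_closure x, point_closure y).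
Proof.
move=> [cB cA] Txy; rewrite tensor_botP => b; split.
- by apply/point_closure_neq0 => ?; apply: b; left.
- by apply/point_closure_neq0 => ?; apply: b; right.
move=> [u v] [/= xu yv].
apply: (cl_min (cA v) _ xu) => _ ->.
by apply: (cl_min (cB x) _ yv) => _ ->.
Qed.

Lemma point_rel_Crel (A B : closureSpace) (T : set (A * B)) :
  tensor A B T -> point_rel (Crel T) = T.
Proof.
move=> tT; apply/seteqP; split=> [[x y] [|[_ _ /= xyT]]|[x y] Txy].
- exact: tensor_bot_sub.
- by apply: xyT; split; exact: sub_cl.
- have [|b] := pselect (tensor_bot A B (x, y)); [by left|right].
  exact: Crel_points.
Qed.

Definition Chom_inv (A B : PCS) (U : hom (Cob A) (Cob B)) : hom A B :=
  SigSub (mem_set (point_rel_tensor (set_mem (valP U)))).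

Lemma Chom_bij (A B : PCS) : bijective (@Chom A B).
Proof.
exists (@Chom_inv A B) => T; apply: val_inj => /=.
  exact: point_rel_Crel (set_mem (valP T)).
exact: Crel_point_rel (set_mem (valP T)).
Qed.

(** Each inclusion is an instance of minimality. From left to right, the image of
    R.S-pairs under point closure lies in the lattice composite U, so the closure
    of R.S lies in [point_rel U]. From right to left, a nonbottom intermediate
    closed set Y supplies an intermediate point outside bot. *)
Lemma Cfunctor_semifunctor : is_semifunctor Cfunctor.
Proof.
move=> A B C R S; apply: val_inj => /=.
have tR : tensor A B (val R) := set_mem (valP R).
have tS : tensor B C (val S) := set_mem (valP S).
set P := rel_prod _ _; set P' := rel_prod _ _.
have tP : tensor A C (smallest (tensor A C) P) := smallest_tensor P.
have tP' : tensor_lattice (closed_lattice A) (closed_lattice C)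
    (smallest (tensor_lattice (closed_lattice A) (closed_lattice C)) P').
  exact: (set_mem (valP (comp (Chom R) (Chom S)))).
apply/seteqP; split.
  rewrite -(Crel_point_rel tP') => -[X Z] [X0 Z0 XZ]; split=> // p /XZ.
  apply: smallest_sub p; first exact: point_rel_tensor.
  move=> [x z] [y [Rxy xy] [Syz yz]]; right; apply: sub_gen_smallest.
  by exists (point_closure y); exact: Crel_points.
apply: smallest_sub; first exact: Crel_tensor.
move=> [X Z] [Y [/= X0 Y0 XYR] [/= _ Z0 YZS]]; split=> // -[x z] [/= Xx Zz].
have [/(tensor_bot_sub tP)//|/tensor_botP xz] := pselect (tensor_bot A C (x, z)).
have [y [Yy yb]] := neq0_point Y0.
apply: sub_gen_smallest; exists y; split; try exact: XYR; try exact: YZS.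
  by move=> /tensor_botP[xb|//]; apply: xz; left.
by move=> /tensor_botP[//|zb]; apply: xz; right.
Qed.

(** * Truncated tensors as tensors of ideal spaces *)

Definition check_point (A : augPoset) (x : A) (xb : ~ ideal_bot A x) :
  check_poset A := SigSub (mem_set xb : x \in ~` ideal_bot A).

Lemma check_neq0 (A : augPoset) (x : check_poset A) : ~ ideal_bot A (val x).
Proof. exact: set_mem (valP x). Qed.

(** The converse of [ideal_extend]. Puncturing removes the upper bounds that lie
    in bot, which could make the cuts larger; but if a member X of the family has
    such an upper bound, then X lies in bot while bot is nonempty, and these are
    exactly the X whose traces the punctured family leaves out. *)
Lemma ideal_restrict (A : augPoset) (I : set A) :
  is_ideal I -> is_ideal (A := check A) [set x | I (val x)].
Proof.
move=> iI X' [[X [dX nX ->]] XI y Dy|[x _ <-] xI y Dy]; last first.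
  have [_ -> yx] := Dy x (ltac:(by move=> _ ->; exists x)).
  apply: ideal_down iI (xI x erefl) _; exact: yx.
apply: (iI X dX) => /= [x Xx|a Xa].
  have [xb|xb] := pselect (ideal_bot A x).
    exact: (@bot_min (ideal_space A)) xb.
  exact: (XI (check_point xb)).
have [ab|ab] := pselect (ideal_bot A a); last first.
  have [x /= Xx|_ -> ya] := Dy (check_point ab); last by exists a.
  by have [_ -> xa] := Xa _ Xx; exists (check_point ab).
case: nX => [[x [/Xa[_ -> xa]]]|A0]; last by rewrite A0 in ab.
by case; apply: ideal_down ab xa; exact: (@closed_cl (ideal_space A)).
Qed.

Definition bot_extend (A B : augPoset)
    (T : set (check_poset A * check_poset B)) : set (A * B) :=
  tensor_bot (ideal_space A) (ideal_space B) `|`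
  [set (val p.1, val p.2) | p in T].

Definition check_restrict (A B : augPoset) (U : set (A * B)) :
    set (check_poset A * check_poset B) := [set p | U (val p.1, val p.2)].

Lemma bot_extendE (A B : augPoset) (T : set (check_poset A * check_poset B))
    (x : check_poset A) (y : check_poset B) :
  bot_extend T (val x, val y) <-> T (x, y).
Proof.
split=> [[/tensor_botP[/check_neq0//|/check_neq0//]|]|Txy].
  by move=> [[u v] /= Tuv [/val_inj <- /val_inj <-]].
by right; exists (x, y).
Qed.

Lemma bot_extend_tensor (A B : augPoset)
    (T : set (check_poset A * check_poset B)) :
  trunc_tensor A B T ->
  tensor (ideal_space A) (ideal_space B) (bot_extend T).
Proof.
move=> [cB cA]; apply: sections_tensor => [p|x xb|y yb]; first by left.
  rewrite (_ : mkset _ = [set y | ideal_bot B y \/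
      exists2 s, T (check_point xb, s) & val s = y]).
    exact: ideal_extend (cB (check_point xb)).
  apply/seteqP; split=> y.
    move=> [/tensor_botP[//|]|[[u v] /= Tuv [ux <-]]]; [by left|right].
    by exists v => //; rewrite (_ : check_point xb = u) //; exact: val_inj.
  case=> [yb|[s Ts <-]]; [by left; apply/tensor_botP; right|].
  by right; exists (check_point xb, s).
rewrite (_ : mkset _ = [set x | ideal_bot A x \/
    exists2 s, T (s, check_point yb) & val s = x]).
  exact: ideal_extend (cA (check_point yb)).
apply/seteqP; split=> x.
  move=> [/tensor_botP[|//]|[[u v] /= Tuv [<- vy]]]; [by left|right].
  by exists u => //; rewrite (_ : check_point yb = v) //; exact: val_inj.
case=> [xb|[s Ts <-]]; [by left; apply/tensor_botP; left|].
by right; exists (s, check_point yb).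
Qed.

Lemma check_restrict_tensor (A B : augPoset) (U : set (A * B)) :
  tensor (ideal_space A) (ideal_space B) U ->
  trunc_tensor A B (check_restrict U).
Proof.
move=> [cB cA]; split=> [x|y].
  exact: (ideal_restrict (cB (val x))).
exact: (ideal_restrict (cA (val y))).
Qed.

Lemma bot_extendK (A B : augPoset) (T : set (check_poset A * check_poset B)) :
  check_restrict (bot_extend T) = T.
Proof. by apply/seteqP; split=> -[x y] /bot_extendE. Qed.

Lemma check_restrictK (A B : augPoset) (U : set (A * B)) :
  tensor (ideal_space A) (ideal_space B) U ->
  bot_extend (check_restrict U) = U.
Proof.
move=> tU; apply/seteqP; split=> [p [|[[x y] Uxy <-]//]|[x y] Uxy].
  exact: tensor_bot_sub.
have [|] := pselect (tensor_bot (ideal_space A) (ideal_space B) (x, y)).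
  by left.
move=> /tensor_botP b; right.
have xb : ~ ideal_bot A x by move=> ?; apply: b; left.
have yb : ~ ideal_bot B y by move=> ?; apply: b; right.
by exists (check_point xb, check_point yb).
Qed.

(** Together with [extend_hom] this is a fully faithful semifunctor from PBD to
    PCS. *)
Definition ideal_pcs (A : PBD) : PCS :=
  PcsObject (ideal_polarized (@pbd_distributive A)).

Definition extend_hom (A B : PBD) (T : hom A B) : hom (ideal_pcs A) (ideal_pcs B) :=
  SigSub (mem_set (bot_extend_tensor (set_mem (valP T)))).

Definition restrict_hom (A B : PBD) (U : hom (ideal_pcs A) (ideal_pcs B)) : hom A B :=
  SigSub (mem_set (check_restrict_tensor (set_mem (valP U)))).

Lemma extend_hom_bij (A B : PBD) : bijective (@extend_hom A B).
Proof.
exists (@restrict_hom A B) => T; apply: val_inj => /=; first exact: bot_extendK.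
exact: check_restrictK (set_mem (valP T)).
Qed.

(** Removing the least tensor from an extended relation gives back the original
    one, so both composites are generated by the same product; extension and
    restriction, being monotone and mutually inverse, exchange the two closures. *)
Lemma extend_hom_comp (A B C : PBD) (R : hom A B) (S : hom B C) :
  extend_hom (comp R S) = comp (extend_hom R) (extend_hom S).
Proof.
apply: val_inj => /=.
set P := rel_prod _ _; set P' := rel_prod _ _.
have tP : trunc_tensor A C (smallest (trunc_tensor A C) P).
  exact: (set_mem (valP (comp R S))).
have tP' : tensor (ideal_space A) (ideal_space C)
    (smallest (tensor (ideal_space A) (ideal_space C)) P').
  exact: smallest_tensor.
apply/seteqP; split; last first.
  apply: smallest_sub; first exact: bot_extend_tensor.
  move=> [a c] [b [[//|[[x y] Rxy [/= <- <-]]] xy] [[//|[[y' z] Syz [/= yy' <-]]] yz]].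
  right; exists (x, z) => //; apply: sub_gen_smallest; exists y => //=.
  by rewrite -(val_inj yy').
rewrite -[X in _ `<=` X]check_restrictK //.
have : smallest (trunc_tensor A C) P `<=`
    check_restrict (smallest (tensor (ideal_space A) (ideal_space C)) P').
  apply: smallest_sub; first exact: check_restrict_tensor.
  move=> [x z] [y Rxy Syz]; apply: sub_gen_smallest; exists (val y).
    split; first exact/bot_extendE.
    by move=> /tensor_botP[/check_neq0|/check_neq0].
  split; first exact/bot_extendE.
  by move=> /tensor_botP[/check_neq0|/check_neq0].
move=> sub p [|[q /sub Pq <-]]; first by left.
by right; exists q.
Qed.

(** The typing of this equation identifies the ideal lattice of A with the lattice
    of closed sets of its ideal space. A pair of ideals has its punctured
    rectangle in T exactly when the whole rectangle lies in the extension of T. *)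
Lemma IhomE (A B : PBD) (T : hom A B) : Ihom T = Chom (extend_hom T).
Proof.
apply: val_inj; apply/seteqP; split=> -[I J] [/= I0 J0 IJT]; split=> //=.
  move=> [x y] [/= Ix Jy].
  have [|] := pselect (tensor_bot (ideal_space A) (ideal_space B) (x, y)).
    by left.
  move=> /tensor_botP b; right.
  have xb : ~ ideal_bot A x by move=> ?; apply: b; left.
  have yb : ~ ideal_bot B y by move=> ?; apply: b; right.
  by exists (check_point xb, check_point yb) => //; exact: IJT.
by move=> x y Ix Jy; apply/bot_extendE; exact: IJT.
Qed.

Lemma Ihom_bij (A B : PBD) : bijective (@Ihom A B).
Proof.
apply: (eq_bij (bij_comp (@Chom_bij (ideal_pcs A) (ideal_pcs B)) (@extend_hom_bij A B))).
by move=> T; rewrite /= IhomE.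
Qed.

Lemma Ifunctor_semifunctor : is_semifunctor Ifunctor.
Proof.
move=> A B C R S; rewrite /= !IhomE extend_hom_comp.
exact: (@Cfunctor_semifunctor (ideal_pcs A) (ideal_pcs B) (ideal_pcs C)).
Qed.

(** * Every pseudocomplemented complete lattice is an ideal lattice *)

Definition power_poset d (L : porderType d) : augPoset :=
  AugPoset (@setT (set L)).

Lemma Delta_bigjoin d (L : tbLatticeType d) (X : set L) :
  complete L -> Delta X = down [set bigjoin X].
Proof.
move=> cL; apply/seteqP; split=> y; last first.
  move=> [_ -> yX] a Xa; exists a => //; apply: le_trans yX _.
  by apply/bigjoin_leP => // x /Xa[_ ->].
apply=> x Xx; exists (bigjoin X) => //; exact: le_bigjoin.
Qed.

Lemma power_ideal d (L : tbLatticeType d) (I : set L) : complete L ->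
  is_ideal (A := power_poset L) I -> I = down [set bigjoin I].
Proof.
move=> cL iI; apply/seteqP; split=> [x Ix|].
  by exists (bigjoin I) => //; exact: le_bigjoin.
by rewrite -Delta_bigjoin //; apply: (iI I) => //; left.
Qed.

Lemma power_ideal_bot d (L : tbLatticeType d) : complete L ->
  ideal_bot (power_poset L) = [set \bot%O].
Proof.
move=> cL; apply/seteqP; split=> x.
  have /bot_min/[apply] : closed (down [set \bot%O] : set (ideal_space (power_poset L))).
    exact: (@ideal_principal (power_poset L)).
  by move=> [_ ->]; rewrite lex0 => /eqP.
move=> ->; set I := ideal_bot _.
have iI : is_ideal I := @closed_cl (ideal_space (power_poset L)) set0.
by rewrite (power_ideal cL iI); exists (bigjoin I) => //; exact: le0x.
Qed.

(** Take z below both x and the join of X. If z were nonzero, it would meet some u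
    in X, and the meet of u and z would be a nonzero common lower bound of x and
    u. *)
Lemma power_distributive d (L : tbLatticeType d) :
  complete L -> pseudocomplemented L ->
  partially_bot_distributive (power_poset L).
Proof.
move=> cL pL x X _; rewrite power_ideal_bot // Delta_bigjoin // => sub.
move=> z [[_ -> zx] [y [_ -> yX] zy]]; apply: contrapT => z0.
have [|u Xu uz] := @bigjoin_meets _ L X z cL pL.
  by rewrite (meet_r (le_trans zy yX)).
apply: uz; apply: (sub (u `&` z)%O); split.
  by exists x => //; exact: le_trans (leIr _ _) zx.
by exists u => //; exact: leIl.
Qed.

Definition power_pbd (L : PCL) : PBD :=
  PbdObject (power_distributive (@pcl_complete L) (@pcl_pseudocomplemented L)).

(** Sending a to its principal ideal is an order isomorphism, with the join of an
    ideal as inverse; hence it preserves meets and joins. *)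
Lemma power_pbd_iso (L : PCL) : pcl_iso L (Iob (power_pbd L)).
Proof.
have cL := @pcl_complete L.
pose f (a : L) : ideal_lattice (power_poset L) :=
  MkClosed (A := ideal_space (power_poset L))
    (@ideal_principal (power_poset L) a).
pose g (I : ideal_lattice (power_poset L)) : L := bigjoin (val I : set L).
have fleE a b : (f a <= f b)%O = (a <= b)%O.
  apply/idP/idP; rewrite leE.
    by move=> /(_ a) []; [exists a|move=> _ ->].
  by move=> ab x [_ -> xa]; exists b => //; exact: le_trans ab.
have gK : cancel g f.
  by move=> I; apply: val_inj; rewrite /= -power_ideal //; exact: (@closed_val (ideal_space (power_poset L))).
have fI : injective f.
  by move=> a b fab; apply/le_anti; rewrite -!fleE fab lexx.
exists f; split.
- by exists g => // a; apply: fI; rewrite gK.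
- move=> a b; rewrite -[RHS]gK; congr f; apply/le_anti.
  by rewrite lexI -!fleE gK leIl leIr lexI !fleE leIl leIr.
- move=> a b; rewrite -[RHS]gK; congr f; apply/le_anti.
  by rewrite leUx -!fleE gK leUl leUr leUx !fleE leUl leUr.
Qed.

Theorem theorem10p1 :
  [/\ is_semicategory PCS, is_semicategory PCL & is_semicategory PBD] /\
  is_equivalence pcl_iso Cfunctor /\
  is_equivalence pcl_iso Ifunctor.
Proof.
split; last split.
- split; last 1 first.
  + apply: (faithful_reflects_semicategory Ifunctor_semifunctor).
      by move=> A B; exact: bij_inj (@Ihom_bij A B).
    exact: PCL_semicategory.
  + apply: (faithful_reflects_semicategory Cfunctor_semifunctor).
      by move=> A B; exact: bij_inj (@Chom_bij A B).
    exact: PCL_semicategory.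
  + exact: PCL_semicategory.
- split; [exact: Cfunctor_semifunctor|exact: Chom_bij|].
  by move=> L; exists (ideal_pcs (power_pbd L)); exact: power_pbd_iso.
- split; [exact: Ifunctor_semifunctor|exact: Ihom_bij|].
  by move=> L; exists (power_pbd L); exact: power_pbd_iso.
Qed.
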